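(* Consider the MAIC diffusion strategy over a clustered network of $N$ nodes with data model, weights and standing assumptions (A1)–(A3) as described in the context. Suppose (A1)–(A3) hold. If the step-sizes satisfy $$0<\mu_k < \frac{2}{\lambda_{\max}(R_{u,k})}\qquad\text{for every } k=1,\dots,N,$$ then MAIC is stable in the mean (for any choice of weights $\{g_{\ell k}\}$ and $\{a_{\ell k}\}$ satisfying the constraints in the context). Furthermore, if in addition all the parameters have the same mean, i.e. there is $\overline{w}\in\mathbb{R}^{M}$ with $\mathbb{E}\,\boldsymbol{w}^\circ_k=\overline{w}$ for all $k=1,\dots,N$, then MAIC is asymptotically unbiased, i.e. $\lim_{i\to\infty}\mathbb{E}\,\widetilde{\boldsymbol{w}}_i = 0$.
   Context: Network. There are $N$ nodes forming a connected undirected graph; $\mathcal{N}_k$ is the set consisting of node $k$ and all its neighbors. The nodes are partitioned into $P$ clusters $C_1,\dots,C_P$; $\mathcal{C}(k)$ denotes the cluster containing node $k$. Put $\mathcal{N}_{C,k}=\mathcal{N}_k\cap\mathcal{C}(k)$, $\mathcal{N}_{I,k}=\mathcal{N}_k\setminus\mathcal{C}(k)$, and $\mathcal{N}_{I,k}^+=\mathcal{N}_{I,k}\cup\{k\}$. Parameters and data. Each cluster $C_p$ has a random parameter vector $\boldsymbol{w}^\circ_{C_p}\in\mathbb{R}^{M}$ (constant in time, with finite second moments), and $\boldsymbol{w}^\circ_k=\boldsymbol{w}^\circ_{C_p}$ for $k\in C_p$. Let $\boldsymbol{w}^\circ\in\mathbb{R}^{MN}$ be the stacked vector of $\boldsymbol{w}^\circ_1,\dots,\boldsymbol{w}^\circ_N$.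 At each time $i\ge 1$ node $k$ observes $\boldsymbol{d}_{k,i}\in\mathbb{R}$ and $\boldsymbol{u}_{k,i}\in\mathbb{R}^{M}$ (column vector), with $$\boldsymbol{d}_{k,i}=\boldsymbol{u}_{k,i}^T\boldsymbol{w}^\circ_k+\boldsymbol{v}_{k,i},$$ where $\boldsymbol{v}_{k,i}$ is a zero-mean real noise. Standing assumptions. (A1) The regressors $\boldsymbol{u}_{k,i}$ are zero-mean, independent across nodes $k$, and temporally white (understood as independent across times $i$), with positive definite covariance $R_{u,k}=\mathbb{E}\,\boldsymbol{u}_{k,i}\boldsymbol{u}_{k,i}^T$ not depending on $i$. (A2) The noises $\boldsymbol{v}_{k,i}$ are independent across nodes $k$ and temporally white (understood as independent across times $i$), with variance $\sigma_{v,k}^2$; the noise process is independent of the regressor process. (A3) The parameters $\{\boldsymbol{w}^\circ_k\}_{k=1}^N$ are independent of all the regressors and noises $\{\boldsymbol{u}_{\ell,i},\boldsymbol{v}_{\ell,i}\}$. MAIC strategy. Given step-sizes $\mu_k>0$ and initial estimates $\boldsymbol{w}_{k,0}\in\mathbb{R}^M$, for every $i\ge1$ and every $k$: $$\boldsymbol{\psi}_{k,i}=\boldsymbol{w}_{k,i-1}+\mu_k\boldsymbol{u}_{k,i}(\boldsymbol{d}_{k,i}-\boldsymbol{u}_{k,i}^T\boldsymbol{w}_{k,i-1}),\qquad \boldsymbol{\phi}_{k,i}=\sum_{\ell\in\mathcal{N}_{I,k}^+}g_{\ell k}\boldsymbol{\psi}_{\ell,i},\qquad \boldsymbol{w}_{k,i}=\sum_{\ell\in\mathcal{N}_{C,k}}a_{\ell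 k}\boldsymbol{\phi}_{\ell,i},$$ where the deterministic weights satisfy $g_{\ell k}\ge0$, $\sum_{\ell\in\mathcal{N}_{I,k}^+}g_{\ell k}=1$, $g_{\ell k}=0$ if $\ell\notin\mathcal{N}_{I,k}^+$; and $a_{\ell k}\ge0$, $\sum_{\ell\in\mathcal{N}_{C,k}}a_{\ell k}=1$, $a_{\ell k}=0$ if $\ell\notin\mathcal{N}_{C,k}$. Initial estimates have finite second moments and are, jointly with $\boldsymbol{w}^\circ$, independent of $\{\boldsymbol{u}_{\ell,i},\boldsymbol{v}_{\ell,i}\}_{i\ge1}$. Errors and stability. $\widetilde{\boldsymbol{w}}_{k,i}=\boldsymbol{w}^\circ_k-\boldsymbol{w}_{k,i}$, and $\widetilde{\boldsymbol{w}}_i\in\mathbb{R}^{MN}$ is the stacked vector of $\widetilde{\boldsymbol{w}}_{1,i},\dots,\widetilde{\boldsymbol{w}}_{N,i}$. MAIC is called stable in the mean if, for every choice of initial estimates, $\mathbb{E}\,\widetilde{\boldsymbol{w}}_i$ converges as $i\to\infty$ to a finite limit not depending on the initial estimates. $\lambda_{\max}(\cdot)$ denotes the largest eigenvalue of a symmetric matrix. *)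

(* Defs.v *)
From HB Require Import structures.
From mathcomp Require Import all_boot all_order all_algebra.
From mathcomp Require Import all_classical all_reals all_analysis.

Set Implicit Arguments.
Unset Strict Implicit.
Unset Printing Implicit Defensive.

Import Order.TTheory GRing.Theory Num.Theory.
Import numFieldNormedType.Exports.

Local Open Scope classical_set_scope.
Local Open Scope ring_scope.

Section Matrices.
Context {R : realType} {n : nat}.

(* The supremum is attained when A is symmetric and n > 0. *)
Definition lambda_max (A : 'M[R]_n) : R := sup [set a | eigenvalue A a].

Definition posdefmx (A : 'M[R]_n) : Prop :=
  A^T = A /\ forall x : 'cV[R]_n, x != 0 -> 0 < (x^T *m A *m x) 0 0.

End Matrices.

Section Probability.
Context {d : measure_display} {T : measurableType d} {R : realType}.
Variable P : probability T R.

(* Membership in Lfun includes measurability of the entries. *)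
Definition mx_Lfun (p : \bar R) {m n} (X : T -> 'M[R]_(m, n)) : Prop :=
  forall i j, (fun t => X t i j) \in Lfun P p.

(* Meaningful only for X such that [mx_Lfun 1 X]. *)
Definition mx_mean {m n} (X : T -> 'M[R]_(m, n)) : 'M[R]_(m, n) :=
  \matrix_(i, j) fine 'E_P[fun t => X t i j].

Definition sigma_rv {I : Type} (X : I -> T -> R) : set (set T) :=
  <<s \bigcup_(i in [set: I]) preimage_set_system setT (X i) measurable >>.

Definition coords {I : Type} {m} (X : I -> T -> 'cV[R]_m) (q : I * 'I_m) :
  T -> R := fun t => X q.1 t q.2 0.

Definition sigma_join (F G : set (set T)) : set (set T) := <<s F `|` G >>.

Definition indep (F G : set (set T)) : Prop :=
  forall A B, F A -> G B -> P (A `&` B) = (P A * P B)%E.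

Definition mutual_indep {I : eqType} (F : I -> set (set T)) : Prop :=
  forall (s : seq I) (A : I -> set T), uniq s ->
    (forall i, i \in s -> F i (A i)) ->
    P (\bigcap_(i in [set` s]) A i) = (\prod_(i <- s) P (A i))%E.

End Probability.

Section Network.
Context {N Q : nat}.
Variables (e : rel 'I_N) (cl : 'I_N -> 'I_Q).

Definition nbhd (k : 'I_N) : {set 'I_N} := [set l | (l == k) || e k l].
Definition cluster (k : 'I_N) : {set 'I_N} := [set l | cl l == cl k].
Definition nbhdC (k : 'I_N) : {set 'I_N} := nbhd k :&: cluster k.
Definition nbhdI (k : 'I_N) : {set 'I_N} := nbhd k :\: cluster k.
Definition nbhdIp (k : 'I_N) : {set 'I_N} := k |: nbhdI k.

(* [W l k] is the weight that node k gives to the data received from l. *)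
Definition weights {R : realType} (nb : 'I_N -> {set 'I_N}) (W : 'M[R]_N) :
  Prop :=
  [/\ forall l k, 0 <= W l k,
      forall k, \sum_(l in nb k) W l k = 1
    & forall l k, l \notin nb k -> W l k = 0].

Section Maic.
Context {R : realType} {M : nat} {T : Type}.
Variables (mu : 'I_N -> R) (g a : 'M[R]_N).

(* Observations are made at times i >= 1: the values at time 0 of u and dd
   are never used. *)
Variables (u : 'I_N -> nat -> T -> 'cV[R]_M) (dd : 'I_N -> nat -> T -> R).

Definition maic_step (i : nat) (w : 'I_N -> T -> 'cV[R]_M) :
  'I_N -> T -> 'cV[R]_M :=
  let psi k t :=
    w k t + (mu k * (dd k i t - ((u k i t)^T *m w k t) 0 0)) *: u k i t in
  let phi k t := \sum_(l in nbhdIp k) g l k *: psi l t in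
  fun k t => \sum_(l in nbhdC k) a l k *: phi l t.

Fixpoint maic (w0 : 'I_N -> T -> 'cV[R]_M) (i : nat) :
  'I_N -> T -> 'cV[R]_M :=
  if i is i'.+1 then maic_step i (maic w0 i') else w0.

Definition maic_err (wo : 'I_N -> T -> 'cV[R]_M) (w0 : 'I_N -> T -> 'cV[R]_M)
  (i : nat) (t : T) : 'cV[R]_(\sum_(k < N) M) :=
  \mxcol_(k < N) (wo k t - maic w0 i k t).

End Maic.
End Network.

Section Stability.
Context {d : measure_display} {T : measurableType d} {R : realType}.
Variable P : probability T R.
Context {N M : nat}.

Definition sigma_regressors (u : 'I_N -> nat -> T -> 'cV[R]_M) :
  set (set T) :=
  sigma_rv (coords (fun p : 'I_N * nat => u p.1 p.2.+1)).

Definition sigma_noises (v : 'I_N -> nat -> T -> R) : set (set T) :=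
  sigma_rv (fun p : 'I_N * nat => v p.1 p.2.+1).

Definition sigma_params (wo : 'I_N -> T -> 'cV[R]_M) : set (set T) :=
  sigma_rv (coords wo).

Variables (u : 'I_N -> nat -> T -> 'cV[R]_M) (v : 'I_N -> nat -> T -> R).
Variable wo : 'I_N -> T -> 'cV[R]_M.

Definition initial_estimates (w0 : 'I_N -> T -> 'cV[R]_M) : Prop :=
  (forall k, mx_Lfun P 2%:E (w0 k)) /\
  indep P (sigma_join (sigma_params w0) (sigma_params wo))
          (sigma_join (sigma_regressors u) (sigma_noises v)).

(* [err w0 i] is the error at time i of the algorithm started from w0. *)
Variables (n : nat) (err : ('I_N -> T -> 'cV[R]_M) -> nat -> T -> 'cV[R]_n).

Definition mean_err_cvg (L : 'cV[R]_n) : Prop :=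
  forall w0, initial_estimates w0 ->
    (forall i, mx_Lfun P 1%:E (err w0 i)) /\
    mx_mean P (err w0 i) @[i --> \oo] --> L.

Definition mean_stable : Prop := exists L : 'cV[R]_n, mean_err_cvg L.

Definition asymptotically_unbiased : Prop := mean_err_cvg 0.

End Stability.

(* Main.v *)
(* Merging the two averaging steps gives weights c_mk = sum_l g_ml a_lk that are
   nonnegative and sum to 1 over m, and the error satisfies
     err_k,i = sum_m c_mk (w°_k - w°_m + err_m,i-1
                 - mu_m (u_m,i u_m,i^T err_m,i-1 + v_m,i u_m,i)).
   The error at time i-1 is independent of u_m,i, so taking expectations yields
   the affine recursion
     x_k,i = sum_m c_mk (I - mu_m R_m) x_m,i-1 + b_k,
     b_k = sum_m c_mk E(w°_k - w°_m).
   Each I - mu_m R_m is symmetric with spectrum in (-1, 1), hence contracts the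
   Euclidean norm, and convex combinations do not increase the largest block
   norm: the recursion converges to its unique fixed point, which is 0 if b = 0. *)

Require Import Defs.
From HB Require Import structures.
From mathcomp Require Import all_boot all_order all_algebra.
From mathcomp Require Import all_classical all_reals all_analysis.
From mathcomp Require Import measurable_realfun ring lra.
Import Order.TTheory GRing.Theory Num.Theory.
Import numFieldNormedType.Exports.
Local Open Scope classical_set_scope.
Local Open Scope ring_scope.

(** * Euclidean contraction of a symmetric matrix *)

Section Dot.
Context {R : realType} {n : nat}.
Implicit Types (x y z : 'rV[R]_n) (B : 'M[R]_n).

Definition dot x y : R := (x *m y^T) 0 0.

Lemma dotC x y : dot x y = dot y x.
Proof. by rewrite /dot -[y *m x^T]trmxK trmx_mul trmxK [RHS]mxE. Qed.

Lemma dotBl x y z : dot (x - y) z = dot x z - dot y z.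
Proof. by rewrite /dot mulmxBl !mxE. Qed.

Lemma dotZl c x y : dot (c *: x) y = c * dot x y.
Proof. by rewrite /dot -scalemxAl mxE. Qed.

Lemma dot_mulmx x B y : dot (x *m B) y = dot x (y *m B^T).
Proof. by rewrite /dot trmx_mul trmxK mulmxA. Qed.

Lemma dotxx x : dot x x = \sum_j x 0 j ^+ 2.
Proof. by rewrite /dot mxE; apply: eq_bigr => j _; rewrite mxE expr2. Qed.

Lemma dotxx_ge0 x : 0 <= dot x x.
Proof. by rewrite dotxx; apply: sumr_ge0 => j _; exact: sqr_ge0. Qed.

Lemma dotxx_eq0 x : (dot x x == 0) = (x == 0).
Proof.
rewrite dotxx psumr_eq0 => [|j _]; last exact: sqr_ge0.
apply/allP/eqP => [x0|-> j _]; last by rewrite mxE expr0n /= eqxx.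
apply/rowP => j; rewrite mxE; apply/eqP; rewrite -sqrf_eq0.
exact: x0 (mem_index_enum j).
Qed.

(** If [y = x *m B] were nonzero, the form at [x - t *: y], which equals
    [t ^+ 2 * q - 2 * t * dot y y], would be negative for small [t > 0]. *)
Lemma psd_isotropic_kernel B x : B^T = B ->
  (forall y, 0 <= dot (y *m B) y) -> dot (x *m B) x = 0 -> x *m B = 0.
Proof.
move=> BT B0 xBx; set y := x *m B; set q := dot (y *m B) y.
apply/eqP; rewrite -dotxx_eq0 eq_le dotxx_ge0 andbT leNgt; apply/negP => s0.
have yBx : dot (y *m B) x = dot y y by rewrite dot_mulmx BT.
have q0 : 0 <= q by exact: B0.
have expand t : 0 <= t ^+ 2 * q - 2 * t * dot y y.
  have := B0 (x - t *: y).
  rewrite mulmxBl -scalemxAl dotBl dotZl [dot (x *m B) _]dotC dotBl.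
  rewrite [dot (y *m B) _]dotC dotBl !dotZl.
  rewrite ![dot x _]dotC xBx yBx [dot y (y *m B)]dotC -/q -/y.
  by congr (0 <= _); ring.
have q1 : 0 < q + 1 by rewrite ltr_wpDl.
(* The minimiser over [t] is [dot y y / q]; the added 1 covers [q = 0] and still gives a negative
   value. *)
have := expand (dot y y / (q + 1)).
rewrite leNgt => /negP; apply.
have -> : (dot y y / (q + 1)) ^+ 2 * q - 2 * (dot y y / (q + 1)) * dot y y =
  - ((dot y y / (q + 1)) ^+ 2 * (q + 2)) by field; rewrite gt_eqF.
by rewrite oppr_lt0 mulr_gt0 ?exprn_gt0 ?divr_gt0 ?ltr_wpDl.
Qed.

Lemma continuous_dot_mulmx B : continuous (fun x => dot (x *m B) x).
Proof.
rewrite (_ : (fun _ => _) = (fun x : 'rV[R]_n =>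
  \sum_j (\sum_k x 0 k * B k j) * x 0 j)); last first.
  by apply/funext => y; rewrite /dot mxE; apply: eq_bigr => j _; rewrite !mxE.
apply: continuous_big => [|j _ x]; first exact: add_continuous.
apply: continuousM; last exact: coord_continuous.
move: x; apply: continuous_big => [|k _ x]; first exact: add_continuous.
by apply: continuousM; [exact: coord_continuous|exact: cst_continuous].
Qed.

Lemma compact_unit_sphere : compact [set x : 'rV[R]_n | dot x x = 1].
Proof.
apply: bounded_closed_compact.
  exists 1; split; first exact: num_real.
  move=> c c1 x /= x1; apply: le_trans (ltW c1).
  (* The matrix norm is the maximum norm, so each entry is compared with the Euclidean length 1. *)
  rewrite [`|x|]mx_normrE; apply/bigmax_leP; split => // -[i j] _ /=.
  rewrite (ord1 i) -(expr_le1 (n := 2))// real_normK ?num_real//.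
  rewrite -x1 dotxx (bigD1 j)//= lerDl; apply: sumr_ge0 => k _.
  exact: sqr_ge0.
rewrite (_ : [set _ | _] = (fun x => dot (x *m 1%:M) x) @^-1` [set 1]); last first.
  by apply/seteqP; split => x /=; rewrite mulmx1.
by apply: closed_comp => [x _|]; [exact: continuous_dot_mulmx|exact: closed_eq].
Qed.

(* The squared operator norm [m] of D is attained at a unit vector [x], which
   then lies in the kernel of [m I - D^2]; that matrix factors as
   [(sqrt m I - D) (sqrt m I + D)], so [sqrt m] or [- sqrt m] is an eigenvalue. *)
Lemma symmetric_contraction (D : 'M[R]_n) : D^T = D ->
  (forall a, eigenvalue D a -> `|a| < 1) ->
  exists2 r : R, 0 <= r < 1 & forall x, dot (x *m D) (x *m D) <= r * dot x x.
Proof.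
move=> DT eigD.
have DDE x : dot (x *m D) (x *m D) = dot (x *m (D *m D)) x.
  by rewrite mulmxA [RHS]dot_mulmx DT.
(* An empty sphere forces every vector to be 0, since a nonzero one could be normalised; then the
   rate 0 works. *)
have [[x0 x01]|nosphere] := pselect ([set x : 'rV[R]_n | dot x x = 1] !=set0);
    last first.
  exists 0; first by rewrite lexx ltr01.
  move=> x; rewrite mul0r; have [->|x0] := eqVneq x 0.
    by rewrite mul0mx /dot mul0mx mxE.
  exfalso; apply: nosphere; exists ((Num.sqrt (dot x x))^-1 *: x) => /=.
  rewrite dotZl dotC dotZl mulrA -expr2 exprVn sqr_sqrtr ?dotxx_ge0// mulVf//.
  by rewrite dotxx_eq0.
have [x] := @compact_EVT_max _ R (fun x => dot (x *m (D *m D)) x) _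
  (ex_intro _ x0 x01) compact_unit_sphere
  (continuous_subspaceT (@continuous_dot_mulmx (D *m D))).
rewrite inE /= => x1 xmax; set m := dot (x *m (D *m D)) x in xmax.
have m0 : 0 <= m by rewrite /m -DDE dotxx_ge0.
(* Both sides are homogeneous of degree 2, so the maximum over the sphere controls all vectors. *)
have bound y : dot (y *m (D *m D)) y <= m * dot y y.
  have [->|y0] := eqVneq y 0; first by rewrite /dot !mul0mx mxE mulr0.
  have yy : 0 < dot y y by rewrite lt_def dotxx_eq0 y0 dotxx_ge0.
  set c := (Num.sqrt (dot y y))^-1.
  have c2 : c ^+ 2 = (dot y y)^-1 by rewrite exprVn sqr_sqrtr// ltW.
  have /xmax : (c *: y) \in [set x : 'rV[R]_n | dot x x = 1].
    by rewrite inE /= dotZl dotC dotZl mulrA -expr2 c2 mulVf// gt_eqF.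
  rewrite -scalemxAl dotZl dotC dotZl mulrA -expr2 c2 dotC.
  by rewrite ler_pdivrMl// mulrC.
exists m; last by move=> y; rewrite DDE.
rewrite m0 /=; set c := Num.sqrt m.
have cc : m = c ^+ 2 by rewrite sqr_sqrtr.
have ker : x *m (m%:M - D *m D) = 0.
  apply: psd_isotropic_kernel.
  - by rewrite linearB /= trmx_mul DT tr_scalar_mx.
  - by move=> y; rewrite mulmxBr mul_mx_scalar dotBl dotZl subr_ge0 bound.
  - by rewrite mulmxBr mul_mx_scalar dotBl dotZl x1 mulr1 subrr.
have x_neq0 : x != 0 by rewrite -dotxx_eq0 x1 oner_neq0.
suff [a eiga am] : exists2 a, eigenvalue D a & `|a| = c.
  by rewrite cc expr_lt1 ?sqrtr_ge0// -am eigD.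
have c0 : 0 <= c by exact: sqrtr_ge0.
set z := x *m (c%:M - D).
have [z0|z0] := eqVneq z 0.
  exists c; last by rewrite ger0_norm.
  apply/eigenvalueP; exists x => //.
  by apply/esym/eqP; rewrite -mul_mx_scalar -subr_eq0 -mulmxBr -/z z0.
exists (- c); last by rewrite normrN ger0_norm.
apply/eigenvalueP; exists z => //.
have : z *m (c%:M + D) = 0.
  rewrite -ker /z -mulmxA; congr (_ *m _).
  rewrite mulmxBl !mulmxDr -scalar_mxM -expr2 -cc.
  by rewrite scalar_mxC opprD addrA addrK.
by move/eqP; rewrite mulmxDr mul_mx_scalar addrC addr_eq0 -scaleNr => /eqP.
Qed.

(** A supremum is an upper bound only for a set bounded above. Summing absolute values over the
    entries of [x *m B = b *: x] bounds [b] by the sum of the absolute entries of [B]. *)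
Lemma eigenvalue_le_lambda_max B a : eigenvalue B a -> a <= lambda_max B.
Proof.
move=> eiga; apply: sup_upper_bound => //; split; first by exists a.
exists (\sum_j \sum_i `|B i j|) => b /eigenvalueP[x xB x0].
apply: le_trans (ler_norm _) _.
set s := \sum_j `|x 0 j|.
have xs j : `|x 0 j| <= s.
  by rewrite /s (bigD1 j)//= lerDl; apply: sumr_ge0 => k _.
have s0 : 0 < s.
  rewrite lt_def sumr_ge0// andbT psumr_eq0//; apply/negP => /allP s0.
  move/negP: x0; apply; apply/eqP/rowP => j; rewrite mxE; apply/eqP.
  by rewrite -normr_eq0; exact: s0 (mem_index_enum j).
rewrite -(ler_pM2r s0) [in leLHS]mulr_sumr mulr_suml.
apply: ler_sum => j _; rewrite -normrM.
have -> : b * x 0 j = (x *m B) 0 j by rewrite xB mxE.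
rewrite mxE mulr_suml; apply: le_trans (ler_norm_sum _ _ _) _.
apply: ler_sum => i _; rewrite normrM mulrC.
exact: ler_wpM2l.
Qed.

(** An eigenvalue of [1%:M - mu *: B] is [1 - mu * l] with [l] an eigenvalue of [B]; positive
    definiteness and the bound on [mu] give [0 < mu * l < 2]. *)
Lemma posdef_step_contraction B mu : posdefmx B ->
  0 < mu < 2 / lambda_max B ->
  exists2 r : R, 0 <= r < 1 &
    forall x, dot (x *m (1%:M - mu *: B)) (x *m (1%:M - mu *: B)) <= r * dot x x.
Proof.
move=> [BT Bpos] /andP[mu0 mu2]; apply: symmetric_contraction.
  by rewrite linearB linearZ /= trmx1 BT.
move=> a /eigenvalueP[x]; rewrite mulmxBr mulmx1 -scalemxAr => xD x0.
set l := (1 - a) / mu.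
have xB : x *m B = l *: x.
  apply: (scalerI (a := mu)); first by rewrite gt_eqF.
  rewrite scalerA /l mulrC divfK ?gt_eqF// scalerBl scale1r -xD.
  by rewrite opprB addrC subrK.
have l_le : l <= lambda_max B.
  by apply: eigenvalue_le_lambda_max; apply/eigenvalueP; exists x.
have l0 : 0 < l.
  have := Bpos x^T; rewrite trmxK xB.
  have -> : (x^T != 0) by rewrite -(trmx0 R) (inj_eq trmx_inj).
  move=> /(_ isT); rewrite -/(dot (l *: x) x) dotZl.
  by rewrite pmulr_lgt0 // lt_def dotxx_eq0 x0 dotxx_ge0.
have lm0 : 0 < lambda_max B by exact: lt_le_trans l0 l_le.
have ml : mu * l < 2.
  rewrite ltr_pdivlMr// in mu2; apply: le_lt_trans mu2.
  by rewrite ler_pM2l.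
have aE : a = 1 - mu * l by rewrite /l mulrC divfK ?gt_eqF//; ring.
have ml0 : 0 < mu * l by rewrite mulr_gt0.
by rewrite ltr_norml aE; apply/andP; split; lra.
Qed.
End Dot.

(** * Affine recursions with stochastic block averaging *)

Lemma cvg_mx {R : realType} {m n : nat} (X : nat -> 'M[R]_(m, n)) (L : 'M[R]_(m, n)) :
  (forall i j, X t i j @[t --> \oo] --> L i j) -> X t @[t --> \oo] --> L.
Proof.
move=> XL A [B LB BA].
have : \forall t \near \oo, forall i j, B i j (X t i j).
  apply: filter_forall => i; apply: filter_forall => j.
  exact: XL.
by apply: filterS => t; exact: BA.
Qed.

Section AffineDiffusion.
Context {R : realType} {N M : nat}.
Variables (C : 'M[R]_N) (D : 'I_N -> 'M[R]_M).

(* Row m of X is block m; sums of products A X B keep the map linear by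
   construction, with matrix the sum of lin_mulmx A *m lin_mulmxr B. *)
Definition diffuse (X : 'M[R]_(N, M)) : 'M[R]_(N, M) :=
  \sum_m C *m delta_mx m m *m X *m D m.

Lemma row_diffuse X k :
  row k (diffuse X) = \sum_m C k m *: (row m X *m D m).
Proof.
rewrite /diffuse linear_sum; apply: eq_bigr => m _ /=.
have CE : row k (C *m delta_mx m m) = C k m *: delta_mx 0 m.
  apply/rowP => j; rewrite !mxE (bigD1 m)//= !mxE eqxx big1 ?addr0// => l lm.
  by rewrite mxE (negbTE lm) mulr0.
by rewrite !row_mul -row_mul CE -!scalemxAl -rowE.
Qed.

Lemma diffuseB X Y : diffuse (X - Y) = diffuse X - diffuse Y.
Proof.
rewrite /diffuse -sumrB; apply: eq_bigr => m _.
by rewrite mulmxBr mulmxBl.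
Qed.

Hypotheses (C_ge0 : forall k m, 0 <= C k m) (C_sum : forall k, \sum_m C k m = 1).

(* Jensen's inequality: the defect is the weighted variance of y. *)
Lemma dot_convex_sum k (y : 'I_N -> 'rV[R]_M) :
  dot (\sum_m C k m *: y m) (\sum_m C k m *: y m) <= \sum_m C k m * dot (y m) (y m).
Proof.
set z := \sum_m _; rewrite -subr_ge0.
have dotz x : dot z x = \sum_m C k m * dot (y m) x.
  rewrite /dot /z mulmx_suml summxE; apply: eq_bigr => m _.
  by rewrite -scalemxAl mxE.
have -> : \sum_m C k m * dot (y m) (y m) - dot z z =
    \sum_m C k m * dot (y m - z) (y m - z).
  under [RHS]eq_bigr => m _.
    rewrite dotBl ![dot _ (_ - _)]dotC !dotBl [dot z (y m)]dotC opprB.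
    rewrite mulrDr mulrBr mulrBr.
    over.
  rewrite !big_split /= !sumrN -dotz -mulr_suml C_sum mul1r; ring.
by apply: sumr_ge0 => m _; rewrite mulr_ge0 ?dotxx_ge0.
Qed.

Hypothesis D_contract : forall m, exists2 r : R, 0 <= r < 1 &
  forall x, dot (x *m D m) (x *m D m) <= r * dot x x.

(** By Jensen, the squared length of a new row is at most an average of contracted ones, so a common
    bound [c] shrinks by the worst block rate. *)
Lemma diffuse_contraction : exists2 r : R, 0 <= r < 1 &
  forall X c, (forall k, dot (row k X) (row k X) <= c) ->
    forall k, dot (row k (diffuse X)) (row k (diffuse X)) <= r * c.
Proof.
have /choice[r rP] m : exists r : R, 0 <= r < 1 /\
    forall x, dot (x *m D m) (x *m D m) <= r * dot x x.
  by have [r] := D_contract m; exists r.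
(* The seed 0 makes the rate nonnegative even without blocks. *)
exists (\big[Num.max/0]_m r m).
  apply/andP; split; first exact: bigmax_ge_id.
  apply/bigmax_ltP; split=> [|m _]; first exact: ltr01.
  by have [/andP[]] := rP m.
move=> X c Xc k; rewrite row_diffuse; apply: le_trans (dot_convex_sum _ _) _.
rewrite -[leRHS]mul1r -(C_sum k) mulr_suml; apply: ler_sum => m _.
rewrite ler_wpM2l//; have [/andP[r0 _] rD] := rP m.
apply: le_trans (rD _) _; apply: ler_pM => //; first exact: dotxx_ge0.
exact: le_bigmax.
Qed.

Lemma cvg_diffuse0 (X : nat -> 'M[R]_(N, M)) :
  (forall i, X i.+1 = diffuse (X i)) -> X i @[i --> \oo] --> (0 : 'M[R]_(N, M)).
Proof.
move=> XE; have [r /andP[r0 r1] rP] := diffuse_contraction.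
pose c := \sum_k dot (row k (X 0%N)) (row k (X 0%N)).
have Xc i k : dot (row k (X i)) (row k (X i)) <= c * r ^+ i.
  elim: i k => [|i IH] k.
    rewrite expr0 mulr1 /c (bigD1 k)//= lerDl.
    by apply: sumr_ge0 => l _; exact: dotxx_ge0.
  by rewrite XE exprS mulrCA; exact: rP.
have geo : c * r ^+ i @[i --> \oo] --> 0.
  by apply: cvg_geometric; rewrite ger0_norm.
apply: cvg_mx => k j; rewrite mxE.
(* The geometric bound concerns squares; continuity of the square root then transfers the limit to
   the entry. *)
have sq : (X i k j) ^+ 2 @[i --> \oo] --> 0.
  apply: (@squeeze_cvgr _ _ _ _ (cst 0) (fun i => c * r ^+ i)) => //; last exact: cvg_cst.
  near=> i; rewrite sqr_ge0 /=; apply: le_trans (Xc i k).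
  rewrite dotxx (bigD1 j)//= mxE lerDl.
  by apply: sumr_ge0 => l _; exact: sqr_ge0.
apply/norm_cvg0P.
under eq_fun do rewrite -sqrtr_sqr.
rewrite -sqrtr0; apply: continuous_cvg => //; exact: sqrt_continuous.
Unshelve. all: by end_near. Qed.

(** The constant sequence at a fixed point obeys the recursion, so it tends to 0. *)
Lemma diffuse_fixed_eq0 X : X = diffuse X -> X = 0.
Proof.
move=> XE; apply/matrixP => k j; rewrite mxE.
have X0 : X k j @[_ --> \oo] --> (0 : 'M[R]_(N, M)) k j.
  exact: (cvg_comp _ _ (@cvg_diffuse0 (fun=> X) (fun=> XE)) (@coord_continuous _ _ _ k j _)).
by move/cvg_lim: X0; rewrite lim_cst// mxE => ->.
Qed.

(** After vectorisation [diffuse] is a matrix [A]. A kernel vector of [1%:M - A] is a fixed point of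
    [diffuse], hence 0, so this square matrix is invertible. *)
Lemma diffuse_fixpoint (b : 'M[R]_(N, M)) : exists L, L = diffuse L + b.
Proof.
pose A := \sum_m lin_mulmx (C *m delta_mx m m) *m lin_mulmxr (D m).
have AE X : mxvec (diffuse X) = mxvec X *m A.
  rewrite /diffuse /A linear_sum mulmx_sumr; apply: eq_bigr => m _ /=.
  by rewrite mulmxA !mul_vec_lin.
have inj (v : 'rV[R]_(N * M)) : v *m (1%:M - A) = 0 -> v = 0.
  move=> vA; rewrite -[v]vec_mxK; set X := vec_mx v.
  have XE : X = diffuse X.
    apply/(can_inj mxvecK); rewrite AE /X vec_mxK.
    by apply/eqP; rewrite -subr_eq0 -{1}[v]mulmx1 -mulmxBr vA.
  by rewrite (diffuse_fixed_eq0 _ XE) linear0.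
have Aunit : 1%:M - A \in unitmx.
  rewrite -row_free_unit -kermx_eq0; apply/eqP/row_matrixP => i.
  by rewrite row0; apply: inj; rewrite -row_mul mulmx_ker row0.
exists (vec_mx (mxvec b *m invmx (1%:M - A))).
set L := vec_mx _; apply: (can_inj mxvecK); rewrite linearD /= AE.
have /(congr1 (fun v => v *m (1%:M - A))) : mxvec L = mxvec b *m invmx (1%:M - A).
  by rewrite vec_mxK.
by rewrite mulmxKV// mulmxBr mulmx1 => <-; rewrite addrC subrK.
Qed.

(** The difference with the fixed point obeys the homogeneous recursion. Choosing [L] before [X]
    makes the limit independent of the starting point. *)
Lemma cvg_affine_diffuse (b : 'M[R]_(N, M)) : exists2 L : 'M[R]_(N, M),
  b = 0 -> L = 0 &
  forall X : nat -> 'M[R]_(N, M), (forall i, X i.+1 = diffuse (X i) + b) ->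
    X i @[i --> \oo] --> L.
Proof.
have [L LE] := diffuse_fixpoint b; exists L.
  by move=> b0; apply: diffuse_fixed_eq0; rewrite {1}LE b0 addr0.
move=> X XE; apply/subr_cvg0; apply: cvg_diffuse0 => i.
by rewrite diffuseB XE {1}LE opprD addrACA subrr addr0.
Qed.

End AffineDiffusion.

(** * Independence *)

Section ProductExpectation.
Local Open Scope ereal_scope.
Context {d : measure_display} {T : measurableType d} {R : realType}.
Variable P : probability T R.

Lemma Lfun_measurable {p : \bar R} {X : T -> R} : X \in Lfun P p -> measurable_fun setT X.
Proof. by rewrite inE => /andP[/[!inE]]. Qed.

(* The joint law of (X, Y) is the product of the marginal laws, so this is Fubini. *)
Lemma indep_expectationM (F G : set (set T)) (X Y : T -> R) :
  indep P F G ->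
  (forall A, measurable A -> F (X @^-1` A)) ->
  (forall A, measurable A -> G (Y @^-1` A)) ->
  X \in Lfun P 1 -> Y \in Lfun P 1 ->
  (X \* Y)%R \in Lfun P 1 /\ 'E_P[X \* Y] = 'E_P[X] * 'E_P[Y].
Proof.
move=> FG FX GY LX LY.
pose X' : {mfun T >-> R} := mfun_Sub (mem_set (Lfun_measurable LX)).
pose Y' : {mfun T >-> R} := mfun_Sub (mem_set (Lfun_measurable LY)).
have mZ : measurable_fun setT (fun t => (X' t, Y' t)).
  by apply: measurable_fun_pair.
pose Z : {mfun T >-> (R * R)%type} := mfun_Sub (mem_set mZ).
pose PX := distribution P X'; pose PY := distribution P Y'.
(* Independence is the product formula on rectangles, which determines the product measure. *)
have PZE A : measurable A -> distribution P Z A = (PX \x PY) A.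
  move=> mA; apply/esym; apply: product_measure_unique => // B C mB mC.
  by apply: FG; [exact: FX|exact: GY].
have mid : measurable_fun [set: R] (@EFin R) by exact: EFin_measurable.
have iX : PX.-integrable setT (@EFin R).
  apply: integrable_pushforward => //; exact/Lfun1_integrable.
have iY : PY.-integrable setT (@EFin R).
  apply: integrable_pushforward => //; exact/Lfun1_integrable.
pose f (z : R * R) : \bar R := (z.1 * z.2)%R%:E.
have mf : measurable_fun setT f.
  by apply/measurable_EFinP; apply: measurable_funM.
(* By Tonelli, the integral of [|x * y|] is the product of two finite absolute first moments. *)
have iPP : (PX \x PY).-integrable setT f.
  apply/integrable12ltyP => //.
  have absE x : \int[PY]_y `|f (x, y)| = `|x%:E| * \int[PY]_y `|y%:E|.
    rewrite -ge0_integralZl//; last exact: measurableT_comp.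
    by apply: eq_integral => y _; rewrite /f EFinM abseM.
  under eq_integral => x _ do rewrite absE.
  rewrite ge0_integralZr//; last 2 first.
    exact: measurableT_comp.
    exact: integral_ge0.
  move/integrableP : iX => [_ iX]; move/integrableP : iY => [_ iY].
  by rewrite lte_mul_pinfty// ?ge0_fin_numE// ?integral_ge0.
have iXY : P.-integrable setT (EFin \o (X \* Y)%R).
  apply/integrableP; split.
    apply/measurable_EFinP/measurable_funM; [exact: Lfun_measurable LX|exact: Lfun_measurable LY].
  have <- : \int[distribution P Z]_z (abse \o f) z =
      \int[P]_t `|(EFin \o (X \* Y)%R) t|.
    rewrite ge0_integral_distribution//; last by move=> y; exact: abse_ge0.
    exact: measurableT_comp.
  rewrite (eq_measure_integral (PX \x PY)); last by move=> A mA _; exact: PZE.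
  by move/integrableP : iPP => [].
split; first exact/Lfun1_integrable.
rewrite unlock.
have <- : \int[distribution P Z]_z f z = \int[P]_t ((X \* Y)%R t)%:E.
  by rewrite integral_distribution.
rewrite (eq_measure_integral (PX \x PY)); last by move=> A mA _; exact: PZE.
rewrite -integral12_prod_meas1//.
have innerE x : \int[PY]_y f (x, y) = x%:E * \int[PY]_y y%:E.
  by rewrite -integralZl.
rewrite (_ : fubini_F _ _ = fun x : R => x%:E * \int[PY]_y y%:E); last first.
  exact/funext/innerE.
have iYfin : \int[PY]_y y%:E \is a fin_num by exact: integrable_fin_num.
rewrite -(fineK iYfin) integralZr// fineK//.
by rewrite !integral_distribution//; exact/Lfun1_integrable.
Qed.

End ProductExpectation.

(** * Generated sigma-algebras and extension of independence *)

Section SigmaAlgebras.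
Context {d : measure_display} {T : measurableType d} {R : realType}.
Variable P : probability T R.
Implicit Types G H : set (set T).

Lemma g_sigma_algebra_setT G : sigma_algebra setT <<s G>>.
Proof. exact: smallest_sigma_algebra. Qed.

Lemma sigma_algebra_setI G : sigma_algebra setT G -> setI_closed G.
Proof.
move=> /measurable_g_measurableTypeE GE A B; rewrite -GE.
exact: measurableI.
Qed.

Lemma sigma_algebra_setT G : sigma_algebra setT G -> G setT.
Proof. by move=> /measurable_g_measurableTypeE <-; exact: measurableT. Qed.

Lemma sigma_algebra_bigcap_seq (I : choiceType) (s : seq I) (A : I -> set T) G :
  sigma_algebra setT G -> (forall i, G (A i)) ->
  G (\bigcap_(i in [set` s]) A i).
Proof.
move=> sG GA; rewrite bigcap_seq; elim/big_ind : _ => //.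
  exact: sigma_algebra_setT.
exact: sigma_algebra_setI.
Qed.

Lemma sigma_rv_preimage {I : Type} (X : I -> T -> R) i A :
  measurable A -> sigma_rv X (X i @^-1` A).
Proof.
move=> mA; apply: sub_sigma_algebra; exists i => //; exists A => //.
by rewrite setTI.
Qed.

Lemma sigma_rv_measurable {I : Type} (X : I -> T -> R) :
  (forall i, measurable_fun setT (X i)) -> sigma_rv X `<=` measurable.
Proof.
move=> mX; apply: smallest_sub; first exact: sigma_algebra_measurable.
by move=> A [i _ [B mB <-]]; exact: mX.
Qed.

Lemma sub_sigma_rv {I J : Type} (X : I -> T -> R) (h : J -> I) :
  sigma_rv (fun j => X (h j)) `<=` sigma_rv X.
Proof.
apply: smallest_sub; first exact: g_sigma_algebra_setT.
by move=> A [j _ XA]; apply: sub_sigma_algebra; exists (h j).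
Qed.

Lemma sigma_join_measurable G H : G `<=` measurable -> H `<=` measurable ->
  sigma_join G H `<=` measurable.
Proof.
move=> mG mH; apply: smallest_sub; first exact: sigma_algebra_measurable.
by move=> A [/mG|/mH].
Qed.

(** Dynkin's pi-lambda argument: for fixed [B], the events satisfying the product formula with [B]
    form a Dynkin system containing the pi-system [G]. *)
Lemma indep_g_sigma_algebra G H : G `<=` measurable -> H `<=` measurable ->
  setI_closed G -> indep P G H -> indep P <<s G >> H.
Proof.
move=> mG mH GI GH A B + HB; rewrite -setI_closed_g_dynkin_g_sigma_algebra//.
have mB := mH _ HB.
suff : <<d G >> `<=` [set A | measurable A /\ P (A `&` B) = (P A * P B)%E].
  by move=> + /[dup] => /[apply] -[].
apply: smallest_sub => [|{}A GA]; last by split; [exact: mG|exact: GH].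
split=> [|{}A [mA PA]|F tF FP].
- by split; [exact: measurableT|rewrite setTI probability_setT mul1e].
- split; first exact: measurableC.
  have PBA : P (B `\` A) = (P B - P (A `&` B))%E.
    by rewrite measureD 1?setIC// -ge0_fin_numE// fin_num_measure.
  rewrite setIC -setDE PBA PA probability_setC//.
  rewrite muleBl ?mul1e// ?fin_num_measure//.
- have mF n : measurable (F n) by have [] := FP n.
  split; first exact: bigcupT_measurable.
  rewrite setI_bigcupl !measure_bigcup//; last first.
  + by under eq_fun do rewrite setIC; exact: trivIset_setIl.
  + by move=> n _; exact: measurableI.
  rewrite muleC -(fineK (fin_num_measure P _ mB)) -nneseriesZl//.
  by apply: eq_eseriesr => n _; rewrite fineK ?fin_num_measure// muleC; have [] := FP n.
Qed.

(** * Independence of a new regressor from the past *)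

Section Past.
Context {I : choiceType}.
Variables (U : I -> set (set T)) (W V G : set (set T)) (s : seq I).

(* W: parameters and initial estimates, V: all the noises, s: the indices of the
   regressors already observed. Keeping the three kinds of events separate makes
   this a pi-system on which independence of a new regressor is a computation. *)
Definition past : set (set T) :=
  [set E | exists A F C, [/\ W A, forall q, U q (F q), V C &
     E = A `&` (\bigcap_(q in [set` s]) F q) `&` C]].

Hypotheses (sU : forall q, sigma_algebra setT (U q)) (sW : sigma_algebra setT W)
  (sV : sigma_algebra setT V) (sG : sigma_algebra setT G).
Hypotheses (UG : forall q, U q `<=` G) (mG : G `<=` measurable)
  (mW : W `<=` measurable) (mV : V `<=` measurable).

Lemma past_setI_closed : setI_closed past.
Proof.
move=> _ _ [A [F [C [WA UF VC ->]]]] [A' [F' [C' [WA' UF' VC' ->]]]].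
exists (A `&` A'), (fun q => F q `&` F' q), (C `&` C'); split.
- exact: sigma_algebra_setI.
- by move=> q; exact: sigma_algebra_setI.
- exact: sigma_algebra_setI.
- by rewrite bigcapI setIACA [X in X `&` _]setIACA.
Qed.

Lemma past_params : W `<=` past.
Proof.
move=> A WA; exists A, (fun=> setT), setT; split => //.
- by move=> q; exact: sigma_algebra_setT.
- exact: sigma_algebra_setT.
- rewrite setIT (_ : \bigcap_(_ in _) _ = setT) ?setIT//.
  by apply/seteqP; split=> // x _ q _.
Qed.

Lemma past_noises : V `<=` past.
Proof.
move=> C VC; exists setT, (fun=> setT), C; split => //.
- exact: sigma_algebra_setT.
- by move=> q; exact: sigma_algebra_setT.
- rewrite (_ : \bigcap_(_ in _) _ = setT) ?setTI//.
  by apply/seteqP; split=> // x _ q _.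
Qed.

Lemma past_regressor q : q \in s -> U q `<=` past.
Proof.
move=> qs B UB; exists setT, (fun r => if r == q then B else setT), setT; split => //.
- exact: sigma_algebra_setT.
- by move=> r; case: eqP => [->//|_]; exact: sigma_algebra_setT.
- exact: sigma_algebra_setT.
- rewrite setIT setTI; apply/seteqP; split=> [x Bx r _|x /(_ q qs)].
    by case: eqP.
  by rewrite eqxx.
Qed.

Lemma past_measurable : past `<=` measurable.
Proof.
move=> _ [A [F [C [WA UF VC ->]]]].
apply: measurableI; last exact: mV.
apply: measurableI; first exact: mW.
by apply: mG; apply: sigma_algebra_bigcap_seq => // q; exact: UG.
Qed.

(** On the pi-system, [A] splits off by independence of [W] from [sigma_join G V], then [C] by
    independence of [G] from [V], and finally [D] from the old regressors by mutual independence. *)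
Lemma past_indep p : uniq s -> p \notin s -> mutual_indep P U -> indep P G V ->
  indep P W (sigma_join G V) -> indep P <<s past >> (U p).
Proof.
move=> us ps U_indep GV WGV; apply: indep_g_sigma_algebra.
- exact: past_measurable.
- by move=> A /UG; exact: mG.
- exact: past_setI_closed.
move=> _ D [A [F [C [WA UF VC ->]]]] UD.
set B := \bigcap_(q in [set` s]) F q.
have GB : G B by apply: sigma_algebra_bigcap_seq => // q; exact: UG.
have GD : G D := UG _ _ UD.
have joinI X : G X -> sigma_join G V (X `&` C).
  move=> GX; apply: (sigma_algebra_setI _ (g_sigma_algebra_setT (G `|` V))).
  - by apply: (@sub_sigma_algebra _ setT (G `|` V)); left.
  - by apply: (@sub_sigma_algebra _ setT (G `|` V)); right.
have PDB : P (D `&` B) = (P D * P B)%E.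
  (* Putting [D] at [p] leaves [F] unchanged on [s], so mutual independence applies over
     [p :: s]. *)
  have UF' q : U q (if q == p then D else F q) by case: eqP => [->|].
  have := U_indep (p :: s) (fun q => if q == p then D else F q).
  rewrite /= ps us => /(_ isT (fun q _ => UF' q)).
  rewrite bigcap_seq !big_cons eqxx.
  have -> : (\big[setI/setT]_(q <- s) (if q == p then D else F q)) = B.
    rewrite /B bigcap_seq; apply: eq_big_seq => q qs.
    by case: eqP => // qp; rewrite -qp qs in ps.
  move=> ->; congr (_ * _)%E; rewrite /B U_indep//.
  by apply: eq_big_seq => q qs; case: eqP => // qp; rewrite -qp qs in ps.
have GDB : G (D `&` B) by exact: sigma_algebra_setI.
have -> : A `&` B `&` C `&` D = A `&` (D `&` B `&` C).
  by apply/seteqP; split=> x /=; tauto.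
rewrite -(setIA A) (WGV A (_ `&` C) WA (joinI _ GDB)) (WGV A (_ `&` C) WA (joinI _ GB)).
rewrite (GV _ C GDB VC) (GV _ C GB VC) PDB.
by rewrite -!muleA; congr (_ * _)%E; rewrite muleC -muleA.
Qed.

End Past.
End SigmaAlgebras.

(** * The error recursion *)

Section MaicError.
Context {R : realType} {N Q M : nat}.
Variables (e : rel 'I_N) (cl : 'I_N -> 'I_Q) (g a : 'M[R]_N).

(** Weights vanish off the neighbourhood; sums over all nodes can then be exchanged freely. *)
Lemma weights_big {V : lmodType R} {nb : 'I_N -> {set 'I_N}} {W : 'M[R]_N} k
    (F : 'I_N -> V) : weights nb W ->
  \sum_(l in nb k) W l k *: F l = \sum_l W l k *: F l.
Proof.
case=> _ _ W0; rewrite [RHS](bigID (mem (nb k)))/= [X in _ + X]big1 ?addr0//.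
by move=> l /W0 ->; rewrite scale0r.
Qed.

Lemma weights_sum {nb : 'I_N -> {set 'I_N}} {W : 'M[R]_N} k :
  weights nb W -> \sum_l W l k = 1.
Proof.
move=> hW; have [_ hW1 _] := hW; rewrite -(hW1 k).
have := weights_big k (fun=> 1 : R^o) hW; rewrite /GRing.scale /=.
by under eq_bigr do rewrite mulr1; under [in RHS]eq_bigr do rewrite mulr1.
Qed.

Hypotheses (g_w : weights (nbhdIp e cl) g) (a_w : weights (nbhdC e cl) a).

(** Transposed so that rows, rather than columns, sum to 1, as [diffuse] expects. *)
Definition combine : 'M[R]_N := (g *m a)^T.

Lemma combine_ge0 k m : 0 <= combine k m.
Proof.
rewrite !mxE; apply: sumr_ge0 => l _.
by case: g_w => g0 _ _; case: a_w => a0 _ _; rewrite mulr_ge0.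
Qed.

Lemma combine_sum k : \sum_m combine k m = 1.
Proof.
rewrite (eq_bigr (fun m => \sum_l g m l * a l k)); last by move=> m _; rewrite !mxE.
rewrite exchange_big /= -[RHS](weights_sum k a_w); apply: eq_bigr => l _.
by rewrite -mulr_suml (weights_sum l g_w) mul1r.
Qed.

Context {T : Type}.
Variable mu : 'I_N -> R.
Variables (u : 'I_N -> nat -> T -> 'cV[R]_M) (dd : 'I_N -> nat -> T -> R).

Lemma maic_stepE i w k t : maic_step e cl mu g a u dd i w k t =
  \sum_m combine k m *:
    (w m t + (mu m * (dd m i t - ((u m i t)^T *m w m t) 0 0)) *: u m i t).
Proof.
rewrite /maic_step (weights_big k _ a_w).
under eq_bigr => l _.
  rewrite (weights_big l _ g_w) scaler_sumr.
  under eq_bigr => m _ do rewrite scalerA mulrC.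
  over.
rewrite exchange_big /=; apply: eq_bigr => m _.
by rewrite -scaler_suml !mxE.
Qed.

Variables (v : 'I_N -> nat -> T -> R) (wo w0 : 'I_N -> T -> 'cV[R]_M).
Hypothesis ddE : forall k i t, (0 < i)%N ->
  dd k i t = ((u k i t)^T *m wo k t) 0 0 + v k i t.

Definition node_err i k t : 'cV[R]_M := wo k t - maic e cl mu g a u dd w0 i k t.

(** The entrywise form makes each random term a product of scalars, with the past error as a
    separate factor from the new regressor. *)
Lemma node_errS i k t j : node_err i.+1 k t j 0 =
  \sum_m combine k m * ((wo k t j 0 - wo m t j 0) + (node_err i m t j 0 -
    mu m * (\sum_l (u m i.+1 t l 0 * u m i.+1 t j 0) * node_err i m t l 0 +
      v m i.+1 t * u m i.+1 t j 0))).
Proof.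
rewrite /node_err /= maic_stepE [LHS]mxE [X in _ + X]mxE summxE.
(* Spreading [wo k] over weights of sum 1 produces the mismatch [wo k - wo m]. *)
rewrite -[wo k t j 0]mul1r -{1}(combine_sum k) mulr_suml -sumrB.
apply: eq_bigr => m _; rewrite [X in _ - X]mxE -mulrBr; congr (_ * _).
rewrite ddE// [X in _ - X]mxE [X in _ - (_ + X)]mxE.
have -> : \sum_l u m i.+1 t l 0 * u m i.+1 t j 0 *
      (wo m t - maic e cl mu g a u dd w0 i m t) l 0 =
    u m i.+1 t j 0 * (((u m i.+1 t)^T *m wo m t) 0 0 -
      ((u m i.+1 t)^T *m maic e cl mu g a u dd w0 i m t) 0 0).
  rewrite ![(_ *m _) 0 0]mxE -sumrB mulr_sumr; apply: eq_bigr => l _.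
  by rewrite !mxE; ring.
rewrite [in RHS](_ : (wo m t - _) j 0 =
  wo m t j 0 - maic e cl mu g a u dd w0 i m t j 0); last by rewrite !mxE.
ring.
Qed.

End MaicError.

(** The measurable structure is left arbitrary so that it can be the sigma-algebra of the past. Only
    regressors with [h < i] enter, whereas all noises are allowed, matching [past]. *)
Lemma node_err_measurable {d : measure_display} {T : measurableType d}
  {R : realType} {N Q M : nat}
  {e : rel 'I_N} {cl : 'I_N -> 'I_Q} {g a : 'M[R]_N} {mu : 'I_N -> R}
  {u : 'I_N -> nat -> T -> 'cV[R]_M} {v dd : 'I_N -> nat -> T -> R}
  {wo w0 : 'I_N -> T -> 'cV[R]_M} (i : nat) :
  weights (nbhdIp e cl) g -> weights (nbhdC e cl) a ->
  (forall k i t, (0 < i)%N ->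
    dd k i t = ((u k i t)^T *m wo k t) 0 0 + v k i t) ->
  (forall k j, measurable_fun setT (fun t => w0 k t j 0)) ->
  (forall k j, measurable_fun setT (fun t => wo k t j 0)) ->
  (forall k h j, (h < i)%N -> measurable_fun setT (fun t => u k h.+1 t j 0)) ->
  (forall k h, measurable_fun setT (v k h.+1)) ->
  forall k j, measurable_fun setT
    (fun t => node_err e cl g a mu u dd wo w0 i k t j 0).
Proof.
move=> g_w a_w ddE mw0 mwo + mv; elim: i => [|i IH] mu_ k j.
  under eq_fun do rewrite /node_err !mxE.
  exact: measurable_funB.
under eq_fun do rewrite (node_errS _ _ _ _ g_w a_w _ _ _ _ _ _ ddE).
have IH' := IH (fun k h j hi => mu_ k h j (ltnW hi)).
apply: measurable_sum => m; apply: measurable_funM => //.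
apply: measurable_funD; first exact: measurable_funB.
apply: measurable_funB => //; apply: measurable_funM => //.
apply: measurable_funD; last by apply: measurable_funM => //; exact: mu_.
apply: measurable_sum => l; apply: measurable_funM => //.
by apply: measurable_funM; exact: mu_.
Qed.

(** * Linearity of finite means *)

Section HasMean.
Context {d : measure_display} {T : measurableType d} {R : realType}.
Variable P : probability T R.
Implicit Types f h : T -> R.

(** Integrability travels with the value, so that linearity needs no side conditions. *)
Definition has_mean f (x : R) := f \in Lfun P 1 /\ ('E_P[f] = x%:E)%E.

Lemma has_mean_fine f : f \in Lfun P 1 -> has_mean f (fine 'E_P[f]).
Proof. by move=> Lf; split=> //; rewrite fineK// expectation_fin_num. Qed.

Lemma has_meanD f h x y : has_mean f x -> has_mean h y ->
  has_mean (fun t => f t + h t) (x + y).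
Proof.
move=> [Lf fx] [Lh hy]; split; first exact: rpredD.
by rewrite [LHS](expectationD Lf Lh) fx hy.
Qed.

Lemma has_meanZ c f x : has_mean f x -> has_mean (fun t => c * f t) (c * x).
Proof.
move=> [Lf fx]; rewrite (_ : (fun _ => _) = c \o* f); last first.
  by apply/funext => t /=; rewrite mulrC.
split; first exact: Lfun_scale.
by rewrite expectationZl// fx.
Qed.

Lemma has_meanB f h x y : has_mean f x -> has_mean h y ->
  has_mean (fun t => f t - h t) (x - y).
Proof.
move=> fx hy; have := has_meanD _ _ _ _ fx (has_meanZ (-1) _ _ hy).
by rewrite mulN1r; under eq_fun do rewrite mulN1r.
Qed.

Lemma has_mean_sum {I : finType} (f : I -> T -> R) (x : I -> R) :
  (forall i, has_mean (f i) (x i)) ->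
  has_mean (fun t => \sum_i f i t) (\sum_i x i).
Proof.
move=> fx; elim: (index_enum I) => [|i s IH].
  under eq_fun do rewrite big_nil.
  rewrite big_nil; split; last exact: (expectation_cst P 0).
  exact: (Lfun_cst P 0 1).
under eq_fun do rewrite big_cons.
by rewrite big_cons; exact: has_meanD.
Qed.

End HasMean.

(** * Recursion for the mean error and its limit *)

Section MeanRecursion.
Context {R : realType} {d : measure_display} {T : measurableType d}.
Variable P : probability T R.
Context {N M Q : nat}.
Variables (e : rel 'I_N) (cl : 'I_N -> 'I_Q).
Variables (wo : 'I_N -> T -> 'cV[R]_M).
Variables (u : 'I_N -> nat -> T -> 'cV[R]_M) (v dd : 'I_N -> nat -> T -> R).
Variables (Ru : 'I_N -> 'M[R]_M) (g a : 'M[R]_N) (mu : 'I_N -> R).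
Hypotheses (wo_L2 : forall k, mx_Lfun P 2%:E (wo k))
  (ddE : forall k i t, (0 < i)%N ->
    dd k i t = ((u k i t)^T *m wo k t) 0 0 + v k i t)
  (u_L2 : forall k i, (0 < i)%N -> mx_Lfun P 2%:E (u k i))
  (u_cov : forall k i, (0 < i)%N ->
    mx_mean P (fun t => u k i t *m (u k i t)^T) = Ru k)
  (u_indep : mutual_indep P (fun p : 'I_N * nat =>
    sigma_rv (coords (fun _ : unit => u p.1 p.2.+1))))
  (v_L2 : forall k i, (0 < i)%N -> v k i \in Lfun P 2%:E)
  (v_mean : forall k i, (0 < i)%N -> ('E_P[v k i] = 0)%E)
  (uv_indep : indep P (sigma_regressors u) (sigma_noises v))
  (g_w : weights (nbhdIp e cl) g) (a_w : weights (nbhdC e cl) a).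

Let Ureg (p : 'I_N * nat) := sigma_rv (coords (fun _ : unit => u p.1 p.2.+1)).

Let L2_L1 (f : T -> R) : f \in Lfun P 2%:E -> f \in Lfun P 1.
Proof. by apply: Lfun_subset12; exact: fin_num_measure. Qed.

Let Ureg_sub p : Ureg p `<=` sigma_regressors u.
Proof.
exact: (sub_sigma_rv (coords (fun p : 'I_N * nat => u p.1 p.2.+1))
  (fun q : unit * 'I_M => (p, q.2))).
Qed.

Let regressors_measurable : sigma_regressors u `<=` measurable.
Proof. by apply: sigma_rv_measurable => -[p j]; apply: Lfun_measurable; exact: u_L2. Qed.

Let noises_measurable : sigma_noises v `<=` measurable.
Proof. by apply: sigma_rv_measurable => p; apply: Lfun_measurable; exact: v_L2. Qed.

Let regressor_product_preimage k i l j A : measurable A ->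
  Ureg (k, i) ((fun t => u k i.+1 t l 0 * u k i.+1 t j 0) @^-1` A).
Proof.
move=> mA; pose X := coords (fun _ : unit => u k i.+1).
pose S := \bigcup_(q in [set: unit * 'I_M]) preimage_set_system setT (X q) measurable.
have mu_ q : measurable_fun (setT : set (g_sigma_algebraType S)) (fun t => u k i.+1 t q 0).
  move=> _ B mB; rewrite setTI; exact: (sigma_rv_preimage X (tt, q)).
by rewrite -[X in Ureg _ X]setTI; apply: (measurable_funM (mu_ l) (mu_ j)).
Qed.

Section Start.
Variable w0 : 'I_N -> T -> 'cV[R]_M.
Hypothesis w0_init : initial_estimates P u v wo w0.

Let err := node_err e cl g a mu u dd wo w0.

Let params_measurable :
  sigma_join (sigma_params w0) (sigma_params wo) `<=` measurable.
Proof.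
have [w0_L2 _] := w0_init.
apply: sigma_join_measurable; apply: sigma_rv_measurable => -[k j];
  apply: Lfun_measurable; [exact: w0_L2|exact: wo_L2].
Qed.

(** The witness is the history generated by initial estimates, parameters, all noises and the
    regressors of times 1 to [i]; the index [(k, i)] denotes the regressor of time [i.+1]. *)
Lemma node_err_regressor_indep i k : exists2 G : set (set T),
  indep P G (Ureg (k, i)) &
  forall m j A, measurable A -> G ((fun t => err i m t j 0) @^-1` A).
Proof.
have [_ w0_indep] := w0_init.
pose s := [seq (l, h) | l <- enum 'I_N, h <- iota 0 i].
pose W := sigma_join (sigma_params w0) (sigma_params wo).
pose G := past Ureg W (sigma_noises v) s.
have sU p : sigma_algebra setT (Ureg p) by exact: g_sigma_algebra_setT.
have sW : sigma_algebra setT W by exact: g_sigma_algebra_setT.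
have sV : sigma_algebra setT (sigma_noises v) by exact: g_sigma_algebra_setT.
exists <<s G >>.
  apply: (@past_indep _ _ _ _ _ _ _ _ (sigma_regressors u)) => //.
  - exact: g_sigma_algebra_setT.
  - rewrite allpairs_uniq ?enum_uniq ?iota_uniq// => -[x1 x2] [y1 y2] _ _ /=.
    by move=> [-> ->].
  - apply/negP => /allpairsP[[l h] [_ /=]].
    by rewrite mem_iota add0n => /andP[_ hi] [_ ih]; rewrite -ih ltnn in hi.
have wrt (F : set (set T)) (f : T -> R) : F `<=` G ->
    (forall A, measurable A -> F (f @^-1` A)) ->
    measurable_fun (setT : set (g_sigma_algebraType G)) f.
  move=> FG Ff _ A mA; rewrite setTI; apply: sub_sigma_algebra.
  by apply: FG; exact: Ff.
have WG : W `<=` G by exact: past_params.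
have VG : sigma_noises v `<=` G by exact: past_noises.
move=> m j A mA.
have mw0 k' j' : measurable_fun (setT : set (g_sigma_algebraType G)) (fun t => w0 k' t j' 0).
  apply: (wrt _ _ WG) => B mB; apply: sub_sigma_algebra; left.
  exact: (sigma_rv_preimage (coords w0) (k', j')).
have mwo k' j' : measurable_fun (setT : set (g_sigma_algebraType G)) (fun t => wo k' t j' 0).
  apply: (wrt _ _ WG) => B mB; apply: sub_sigma_algebra; right.
  exact: (sigma_rv_preimage (coords wo) (k', j')).
have mu_ k' h j' : (h < i)%N ->
    measurable_fun (setT : set (g_sigma_algebraType G)) (fun t => u k' h.+1 t j' 0).
  move=> hi; apply: (wrt (Ureg (k', h))).
    apply: past_regressor => //; apply/allpairsP; exists (k', h).
    by rewrite mem_enum mem_iota add0n.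
  by move=> B mB; exact: (sigma_rv_preimage (coords (fun _ : unit => u k' h.+1)) (tt, j')).
have mv k' h : measurable_fun (setT : set (g_sigma_algebraType G)) (v k' h.+1).
  apply: (wrt _ _ VG) => B mB.
  exact: (sigma_rv_preimage (fun p : 'I_N * nat => v p.1 p.2.+1) (k', h)).
(* Measurability over the history sigma-algebra says that the error is a function of the history. *)
have := node_err_measurable (T := g_sigma_algebraType G) i g_w a_w ddE mw0 mwo mu_ mv m j.
by move=> /(_ mu measurableT A mA); rewrite setTI.
Qed.

Definition step_matrix m : 'M[R]_M := 1%:M - mu m *: Ru m.

Definition bias : 'M[R]_(N, M) := \matrix_(k, j) \sum_m combine g a k m *
  (mx_mean P (wo k) j 0 - mx_mean P (wo m) j 0).

Let has_mean_regressor_product m i l j :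
  has_mean P (fun t => u m i.+1 t l 0 * u m i.+1 t j 0) (Ru m l j).
Proof.
have -> : Ru m l j = fine 'E_P[fun t => u m i.+1 t l 0 * u m i.+1 t j 0].
  rewrite -(u_cov m i.+1)// mxE; congr (fine 'E_P[_]); apply/funext => t.
  by rewrite mxE big_ord1 mxE.
apply: has_mean_fine; apply: Lfun2_mul_Lfun1; exact: u_L2.
Qed.

(** Noise and regressor are independent and the noise is centred, so the gradient noise averages
    out. *)
Let has_mean_noise_regressor m i j :
  has_mean P (fun t => v m i.+1 t * u m i.+1 t j 0) 0.
Proof.
have vu_indep : indep P (sigma_noises v) (sigma_regressors u).
  by move=> A B VA UB; rewrite setIC muleC uv_indep.
have Lv := L2_L1 _ (v_L2 m i.+1 isT).
have Lu := L2_L1 _ (u_L2 m i.+1 isT j 0).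
have [Lvu vuE] := @indep_expectationM _ _ _ P _ _ _ _ vu_indep
  (sigma_rv_preimage (fun p : 'I_N * nat => v p.1 p.2.+1) (m, i))
  (sigma_rv_preimage (coords (fun p : 'I_N * nat => u p.1 p.2.+1)) ((m, i), j)) Lv Lu.
split; first exact: Lvu.
by rewrite [LHS]vuE v_mean// mul0e.
Qed.

Lemma has_mean_node_errS i (X : 'M[R]_(N, M)) :
  (forall k j, has_mean P (fun t => err i k t j 0) (X k j)) ->
  forall k j, has_mean P (fun t => err i.+1 k t j 0)
    ((diffuse (combine g a) step_matrix X + bias) k j).
Proof.
move=> errX k j.
under eq_fun do rewrite /err (node_errS _ _ _ _ g_w a_w _ _ _ _ _ _ ddE).
have -> : (diffuse (combine g a) step_matrix X + bias) k j =
  \sum_m combine g a k m * ((mx_mean P (wo k) j 0 - mx_mean P (wo m) j 0) +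
    (X m j - mu m * (\sum_l Ru m l j * X m l + 0))).
  (* Blocks are rows, so [step_matrix] multiplies on the right and the sum runs over the row index
     of [Ru m]. *)
  have diffuseE : diffuse (combine g a) step_matrix X k j =
      \sum_m combine g a k m * (X m j - mu m * \sum_l Ru m l j * X m l).
    transitivity (row k (diffuse (combine g a) step_matrix X) 0 j).
      by rewrite [RHS]mxE.
    rewrite row_diffuse summxE; apply: eq_bigr => m _.
    rewrite [LHS]mxE /step_matrix mulmxBr mulmx1 -scalemxAr; congr (_ * _).
    rewrite [LHS]mxE [X in X + _]mxE [X in _ + X]mxE; congr (_ - _).
    rewrite [LHS]mxE; congr (_ * _); rewrite mxE; apply: eq_bigr => l _.
    by rewrite mxE mulrC.
  rewrite [LHS]mxE diffuseE mxE -big_split; apply: eq_bigr => m _ /=.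
  by rewrite addr0 -mulrDr addrC.
apply: has_mean_sum => m; apply: has_meanZ; apply: has_meanD.
  by apply: has_meanB; rewrite mxE; apply: has_mean_fine; apply: L2_L1; exact: wo_L2.
apply: has_meanB; first exact: errX.
apply: has_meanZ; apply: has_meanD; last exact: has_mean_noise_regressor.
apply: has_mean_sum => l.
(* The product [u_l * u_j] depends on the new regressor alone, so its mean factors out from that of
   the past error. *)
have [G G_indep Gerr] := node_err_regressor_indep i m.
have indep' : indep P (Ureg (m, i)) G.
  by move=> A B UA GB; rewrite setIC muleC G_indep.
have [Luu uuE] := has_mean_regressor_product m i l j.
have [Lerr errE] := errX m l.
have [Lprod prodE] := @indep_expectationM _ _ _ P _ _ _ _ indep'
  (fun A => @regressor_product_preimage m i l j A) (Gerr m l) Luu Lerr.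
by split; [exact: Lprod|rewrite [LHS]prodE uuE errE].
Qed.

Lemma has_mean_node_err : exists2 X : nat -> 'M[R]_(N, M),
  forall i, X i.+1 = diffuse (combine g a) step_matrix (X i) + bias &
  forall i k j, has_mean P (fun t => err i k t j 0) (X i k j).
Proof.
have [w0_L2 _] := w0_init.
pose X0 : 'M[R]_(N, M) := \matrix_(k, j) fine 'E_P[fun t => err 0%N k t j 0].
exists (fun i => iter i (fun X => diffuse (combine g a) step_matrix X + bias) X0) => //.
elim=> [|i IH] k j; last exact: has_mean_node_errS.
rewrite mxE; apply: has_mean_fine.
rewrite (_ : (fun _ => _) = (fun t => wo k t j 0) \- (fun t => w0 k t j 0)); last first.
  by apply/funext => t; rewrite /err /node_err !mxE.
by apply: rpredB; apply: L2_L1; [exact: wo_L2|exact: w0_L2].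
Qed.

End Start.

Hypotheses (Ru_pos : forall k, posdefmx (Ru k))
  (mu_bound : forall k, 0 < mu k < 2 / lambda_max (Ru k)).

(** The limit depends only on [bias] and the step matrices, hence is fixed before the initial
    estimates are introduced. *)
Lemma mean_maic_err_cvg : exists2 L,
  bias = 0 -> L = 0 & mean_err_cvg P u v wo (maic_err e cl mu g a u dd wo) L.
Proof.
have D_contract m := posdef_step_contraction (Ru m) (mu m) (Ru_pos m) (mu_bound m).
have [L b0 XL] := cvg_affine_diffuse (combine g a) step_matrix
  (combine_ge0 _ _ _ _ g_w a_w) (combine_sum _ _ _ _ g_w a_w) D_contract bias.
exists (\mxcol_(k < N) (row k L)^T).
  by move=> /b0 ->; apply/matrixP => s j; rewrite !mxE.
move=> w0 w0_init; have [X XE errX] := has_mean_node_err w0 w0_init.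
(* Index [s] of the stacked vector is entry [tagnat.sig2 s] of block [tagnat.sig1 s]. *)
have errE i s j : (fun t => maic_err e cl mu g a u dd wo w0 i t s j) =
    (fun t => node_err e cl g a mu u dd wo w0 i (tagnat.sig1 s) t (tagnat.sig2 s) 0).
  by apply/funext => t; rewrite /maic_err mxE (ord1 j).
split=> [i s j|]; first by rewrite errE; have [] := errX i (tagnat.sig1 s) (tagnat.sig2 s).
apply: cvg_mx => s j.
under eq_fun => i.
  rewrite mxE errE (errX i _ _).2 /=.
  over.
rewrite !mxE.
exact: (cvg_comp _ _ (XL X XE) (@coord_continuous _ _ _ _ _ _)).
Qed.

End MeanRecursion.

Theorem theorem1 (R : realType) (d : measure_display) (T : measurableType d)
  (P : probability T R) (N M Q : nat)
  (* network and clusters *)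
  (e : rel 'I_N) (e_sym : symmetric e) (e_irr : irreflexive e)
  (e_conn : forall k l, connect e k l)
  (cl : 'I_N -> 'I_Q) (cl_surj : forall p, exists k, cl k = p)
  (* data model *)
  (wC : 'I_Q -> T -> 'cV[R]_M) (wC_L2 : forall p, mx_Lfun P 2%:E (wC p))
  (wo : 'I_N -> T -> 'cV[R]_M) (woE : forall k, wo k = wC (cl k))
  (u : 'I_N -> nat -> T -> 'cV[R]_M) (v dd : 'I_N -> nat -> T -> R)
  (ddE : forall k i t, (0 < i)%N ->
    dd k i t = ((u k i t)^T *m wo k t) 0 0 + v k i t)
  (* (A1) *)
  (Ru : 'I_N -> 'M[R]_M)
  (u_L2 : forall k i, (0 < i)%N -> mx_Lfun P 2%:E (u k i))
  (u_mean : forall k i, (0 < i)%N -> mx_mean P (u k i) = 0)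
  (u_cov : forall k i, (0 < i)%N ->
    mx_mean P (fun t => u k i t *m (u k i t)^T) = Ru k)
  (Ru_pos : forall k, posdefmx (Ru k))
  (u_indep : mutual_indep P (fun p : 'I_N * nat =>
    sigma_rv (coords (fun _ : unit => u p.1 p.2.+1))))
  (* (A2) *)
  (sigma_v : 'I_N -> R)
  (v_L2 : forall k i, (0 < i)%N -> v k i \in Lfun P 2%:E)
  (v_mean : forall k i, (0 < i)%N -> ('E_P[v k i] = 0)%E)
  (v_var : forall k i, (0 < i)%N -> ('V_P[v k i] = ((sigma_v k) ^+ 2)%:E)%E)
  (v_indep : mutual_indep P (fun p : 'I_N * nat =>
    sigma_rv (fun _ : unit => v p.1 p.2.+1)))
  (uv_indep : indep P (sigma_regressors u) (sigma_noises v))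
  (* (A3) *)
  (wo_indep : indep P (sigma_params wo)
    (sigma_join (sigma_regressors u) (sigma_noises v)))
  (* weights and step-sizes *)
  (g a : 'M[R]_N) (g_w : weights (nbhdIp e cl) g) (a_w : weights (nbhdC e cl) a)
  (mu : 'I_N -> R) (mu_bound : forall k, 0 < mu k < 2 / lambda_max (Ru k)) :
  let err := maic_err e cl mu g a u dd wo in
  mean_stable P u v wo err /\
  ((exists wbar : 'cV[R]_M, forall k, mx_mean P (wo k) = wbar) ->
   asymptotically_unbiased P u v wo err).
Proof.
move=> err.
have wo_L2 k : mx_Lfun P 2%:E (wo k) by rewrite woE.
have [L bias0 errL] := mean_maic_err_cvg P e cl wo u v dd Ru g a mu wo_L2 ddE
  u_L2 u_cov u_indep v_L2 v_mean uv_indep g_w a_w Ru_pos mu_bound.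
split; first by exists L.
(* Equal parameter means cancel every difference in [bias], which makes the limit 0. *)
move=> [wbar wbarE]; rewrite /asymptotically_unbiased -bias0//.
apply/matrixP => k j; rewrite [LHS]mxE [RHS]mxE big1// => m _.
by rewrite !wbarE subrr mulr0.
Qed.
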